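(* Let $\beta\in(0,1)$ and $\nu\ge 0$. The nonlinear fractional equation $$t^{1-\nu}\frac{\partial^\beta}{\partial t^\beta}\left(t^{\nu}\frac{\partial u}{\partial t}\right)+u\frac{\partial u}{\partial x}=-u^2-\beta u,$$ where $\frac{\partial^\beta}{\partial t^\beta}$ is the Caputo fractional derivative of order $\beta$ in $t$, admits the solution $$u(x,t)=e^{-x}\cdot W_{\beta,\nu}(-t^\beta).$$
   Context: The Wright function is the entire function $W_{\lambda,\mu}(z)=\sum_{n=0}^{\infty}\frac{z^n}{n!\,\Gamma(\lambda n+\mu)}$, for $\lambda>-1$, $\mu\in\mathbb{C}$ (with $1/\Gamma$ taken to be $0$ at the poles of $\Gamma$). For $0<\beta<1$ the Caputo fractional derivative of order $\beta$ in $t$ of a function $g(x,t)$ is $\left(\frac{\partial^\beta}{\partial t^\beta}g\right)(x,t)=\frac{1}{\Gamma(1-\beta)}\int_0^t\frac{\partial_\tau g(x,\tau)}{(t-\tau)^{\beta}}\,d\tau$. In the equation it is applied to $t^\nu\,\partial u/\partial t$.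
   Formalization: The condition β+ν>1 is added: for β+ν<1 (e.g. ν=0) the Caputo integral of t^ν ∂u/∂t diverges at 0, and for β+ν=1 its leading term is a constant with zero Caputo derivative, so the equation fails. *)

(* Defs.v *)
From HB Require Import structures.
From mathcomp Require Import all_boot all_order all_algebra.
From mathcomp Require Import all_classical all_reals all_analysis.

Set Implicit Arguments.
Unset Strict Implicit.
Unset Printing Implicit Defensive.

Import Order.TTheory GRing.Theory Num.Theory.
Import numFieldNormedType.Exports.

Local Open Scope classical_set_scope.
Local Open Scope ring_scope.

Definition euler_integral (R : realType) (x : R) : R :=
  \int[lebesgue_measure]_(s in `]0, +oo[) (s `^ (x - 1) * expR (- s)).

(* The Gamma function on the whole real line: Euler's integral for 0 < x,
   extended to x <= 0 by Gamma (x + n) = x (x + 1) ... (x + n - 1) Gamma x,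
   where n is the least integer with 0 < x + n.  At a pole x = 0, -1, -2, ...
   the product contains the factor 0, so that Gamma x = 0 and hence
   (Gamma x)^-1 = 0, which is the value of the entire function 1 / Gamma. *)
Definition Gamma (R : realType) (x : R) : R :=
  if 0 < x then euler_integral x
  else let n := (Num.truncn (- x)).+1 in
       euler_integral (x + n%:R) / \prod_(k < n) (x + k%:R).

(* The Wright function for real parameters and a real argument. *)
Definition Wright (R : realType) (lambda mu z : R) : R :=
  limn (series (fun n : nat =>
    z ^+ n / n`!%:R * (Gamma (lambda * n%:R + mu))^-1)).

Section Caputo.
Variables (R : realType) (beta : R) (g : R -> R).

Definition caputo_integrand (t tau : R) : R := derive1 g tau / (t - tau) `^ beta.

(* [derive1] and the integral are total functions, so the existence of the
   Caputo derivative has to be stated separately. *)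
Definition caputo_exists (t : R) : Prop :=
  (forall tau, 0 < tau < t -> derivable g tau 1) /\
  lebesgue_measure.-integrable `]0, t[ (EFin \o caputo_integrand t).

Definition caputo (t : R) : R :=
  (Gamma (1 - beta))^-1 *
  \int[lebesgue_measure]_(tau in `]0, t[) caputo_integrand t tau.

End Caputo.

(* [u x t] is a classical solution on the half-plane t > 0 (x real): all the
   derivatives occurring in the equation exist and the equation holds. *)
Definition is_solution (R : realType) (beta nu : R) (u : R -> R -> R) : Prop :=
  forall x t : R, 0 < t ->
    let u_t := derive1 (u x) in
    let u_x := derive1 (fun y => u y t) in
    let g := fun s : R => s `^ nu * u_t s in
    [/\ derivable (u x) t 1,
        derivable (fun y => u y t) x 1,
        caputo_exists beta g t &
        t `^ (1 - nu) * caputo beta g t + u x t * u_x x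
          = - (u x t) ^+ 2 - beta * u x t].

(* Main.v *)
Require Import Defs.
From HB Require Import structures.
From mathcomp Require Import all_boot all_order all_algebra.
From mathcomp Require Import all_classical all_reals all_analysis.
From mathcomp Require Import measurable_realfun ring lra.

Set Implicit Arguments.
Unset Strict Implicit.
Unset Printing Implicit Defensive.

Import Order.TTheory GRing.Theory Num.Theory.
Import numFieldNormedType.Exports.

Local Open Scope classical_set_scope.
Local Open Scope ring_scope.

(** Write W_m for the Wright function of parameters beta and m. Everything
    rests on two term-by-term computations on functions of the form
    t^(m-1) W_m(-t^beta), which are sums of powers t^(beta k + m - 1)
    weighted by (-1)^k / (k! Gamma (beta k + m)).

    - Differentiation lowers m by one when m > 1: the factor beta k + m - 1
      produced by the power rule is absorbed by
      Gamma (beta k + m) = (beta k + m - 1) Gamma (beta k + m - 1)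
      ([is_derive_powR_Wright]).
    - Convolution with t^(q-1) raises m by q and multiplies by Gamma q:
      on each power this is Euler's beta integral, whose value
      Gamma p Gamma q / Gamma (p + q) replaces the weight
      1 / Gamma (beta k + m) by 1 / Gamma (beta k + m + q)
      ([fractional_integral_Wright]).

    Since W_m' = W_(beta + m), the function t^nu u_t equals
    - beta e^(-x) t^(beta + nu - 1) W_(beta + nu)(-t^beta). Its derivative has
    parameter beta + nu - 1, which is positive because 1 < beta + nu; the
    Caputo derivative then convolves with t^(-beta), that is, with q = 1 - beta,
    and lands on parameter nu. Altogether the fractional term is - beta u, and
    u u_x = - u^2 because of the factor e^(-x).

    What has to be built for this is the real Gamma function. The identity
    B(p, q) Gamma (p + q) = Gamma p Gamma q, obtained from Tonelli's theorem in
    the extended reals where no convergence question arises ([eGammaM]), gives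
    not only the beta integral but also, for q = 1, the functional equation;
    the latter together with Gamma 1 = 1 yields the finiteness of Gamma.
    Analytically, the only estimate on Gamma that is needed is a uniform
    positive lower bound on the positive half-line ([Gamma_ge]): it makes the
    terms of the Wright series smaller than a constant times those of the
    exponential series. *)

Lemma gt0_powRD {R : realType} (x r s : R) : 0 < x ->
  x `^ (r + s) = x `^ r * x `^ s.
Proof. by move=> x0; rewrite powRD// (gt_eqF x0) implybT. Qed.

(** * Affine change of variable in Lebesgue integrals *)

Section affine_change_of_variable.
Context {R : realType}.
Local Notation mu := (@lebesgue_measure R).

Lemma measurable_affine (a b : R) :
  measurable_fun setT (fun x : R => a * x + b).
Proof. by apply: measurable_funD => //; exact: measurable_funM. Qed.

(** The right-hand side is a measure in [A], so that by uniqueness of the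
    Lebesgue measure it suffices to compare both sides on half-open
    intervals. *)
Lemma lebesgue_measure_affine (a : {nonneg R}) (b : R) (A : set R) :
  0 < a%:num -> measurable A ->
  (mu A = a%:num%:E *
    pushforward mu
      ((fun x => (a%:num * x + b)%R) : R -> measurableTypeR R) A)%E.
Proof.
move=> a0 mA.
pose phi := ((fun x => (a%:num * x + b)%R) : R -> measurableTypeR R).
have mphi : measurable_fun [set: measurableTypeR R] phi.
  exact: measurable_affine.
pose nu : {measure set (measurableTypeR R) -> \bar R} :=
  mscale a
    (measure_function_pushforward__canonical__measure_function_Measure mu mphi).
apply: (@lebesgue_measure_unique R nu) => // _ [[l r]] _ <-.
rewrite /nu/= /mscale/= /pushforward/= /phi.
have -> : (fun x : R => a%:num * x + b) @^-1` `]l, r] =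
  `](l - b) / a%:num, (r - b) / a%:num]%classic.
  apply/seteqP; split => x /=; rewrite !in_itv/= ltr_pdivrMr// ler_pdivlMr//.
    by rewrite ltrBlDr lerBrDr mulrC.
  by rewrite ltrBlDr lerBrDr mulrC.
rewrite !lebesgue_measure_itv/= !lte_fin ltr_pM2r ?invr_gt0// ltrD2r.
case: ifPn => _; last by rewrite mule0.
rewrite -!EFinB -EFinM -mulrBl mulrCA mulfV ?gt_eqF// mulr1.
by congr EFin; ring.
Qed.

Lemma ge0_integral_affine (a b : R) (f : R -> R) : 0 < a ->
  measurable_fun setT f -> (forall x, 0 <= f x) ->
  (\int[mu]_x (f x)%:E = a%:E * \int[mu]_x (f (a * x + b))%:E)%E.
Proof.
move=> a0 mf f0.
have mphi : measurable_fun [set: R]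
    ((fun x => (a * x + b)%R) : R -> measurableTypeR R).
  exact: measurable_affine.
rewrite (eq_measure_integral
  (mscale (NngNum (ltW a0)) (pushforward mu
    ((fun x => (a * x + b)%R) : R -> measurableTypeR R)))).
  rewrite ge0_integral_mscale//=.
  - rewrite ge0_integral_pushforward//=.
    + exact/measurable_EFinP.
    + by move=> x _; rewrite lee_fin.
  - exact/measurable_EFinP.
  - by move=> x _; rewrite lee_fin.
by move=> A mA _; apply: lebesgue_measure_affine.
Qed.

End affine_change_of_variable.

(** * Truncated powers and Euler's integrals in the extended reals *)

Section euler_integrals.
Context {R : realType}.
Local Notation mu := (@lebesgue_measure R).
Implicit Types p q x s t : R.

(** The convolution kernel x_+^(p-1). Extending the power by zero turns Euler's
    integrals into integrals over the whole line, where translations and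
    Tonelli's theorem apply without any bookkeeping of domains. *)
Definition tpow p x : R := if 0 < x then x `^ (p - 1) else 0.

Lemma tpow_ge0 p x : 0 <= tpow p x.
Proof. by rewrite /tpow; case: ifP => // _; exact: powR_ge0. Qed.

Lemma tpow_gt0E p x : 0 < x -> tpow p x = x `^ (p - 1).
Proof. by rewrite /tpow => ->. Qed.

Lemma tpow_le0 p x : x <= 0 -> tpow p x = 0.
Proof. by rewrite /tpow ltNge => ->. Qed.

Lemma measurable_tpow p : measurable_fun setT (tpow p).
Proof. by apply: measurable_fun_ifT => //; exact: measurable_fun_ltr. Qed.

Lemma tpowMl p a x : 0 < a -> tpow p (a * x) = a `^ (p - 1) * tpow p x.
Proof.
move=> a0; rewrite /tpow pmulr_rgt0//.
case: ifPn => [x0|]; last by rewrite mulr0.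
by rewrite powRM// ltW.
Qed.

(** Euler's integrals are taken with values in the extended reals, so that they
    can be computed with before they are known to converge. *)
Definition eGamma p : \bar R := (\int[mu]_x (tpow p x * expR (- x))%:E)%E.

Definition eBeta p q : \bar R := (\int[mu]_x (tpow p x * tpow q (1 - x))%:E)%E.

Lemma eGamma_ge0 p : (0 <= eGamma p)%E.
Proof.
by apply: integral_ge0 => x _; rewrite lee_fin mulr_ge0 ?tpow_ge0// expR_ge0.
Qed.

Lemma eBeta_ge0 p q : (0 <= eBeta p q)%E.
Proof. by apply: integral_ge0 => x _; rewrite lee_fin mulr_ge0 ?tpow_ge0. Qed.

Lemma measurable_tpow_prod p q t :
  measurable_fun setT (fun x => tpow p x * tpow q (t - x)).
Proof.
apply: measurable_funM; first exact: measurable_tpow.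
apply: measurableT_comp; first exact: measurable_tpow.
exact: measurable_funB.
Qed.

Lemma measurable_gamma_density p :
  measurable_fun setT (fun x => tpow p x * expR (- x)).
Proof.
apply: measurable_funM; first exact: measurable_tpow.
by apply: measurableT_comp => //; exact: measurable_funN.
Qed.

(** By homogeneity: for 0 < t the substitution x = t y pulls out
    t * t^(p-1) * t^(q-1), and for t <= 0 the supports of the two factors do not
    meet. *)
Lemma tpow_conv p q t :
  (\int[mu]_x (tpow p x * tpow q (t - x))%:E =
   (tpow (p + q) t)%:E * eBeta p q)%E.
Proof.
have [t0|t0] := leP t 0.
  rewrite tpow_le0// mul0e integral0_eq// => x _.
  have [x0|x0] := leP x 0; first by rewrite tpow_le0 ?mul0r.
  by rewrite (@tpow_le0 q) ?mulr0// subr_le0 (le_trans t0)// ltW.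
rewrite (ge0_integral_affine 0 t0 (measurable_tpow_prod p q t)); last first.
  by move=> x; rewrite mulr_ge0 ?tpow_ge0.
transitivity (t%:E * \int[mu]_x ((t `^ (p - 1) * t `^ (q - 1))%:E *
    (tpow p x * tpow q (1 - x))%:E))%E.
  congr (_ * _)%E; apply: eq_integral => x _.
  rewrite addr0 -{2}[t]mulr1 -mulrBr !tpowMl// -EFinM; congr EFin.
  by rewrite mulrACA.
rewrite ge0_integralZl_EFin//; last 3 first.
- by move=> x _; rewrite lee_fin mulr_ge0 ?tpow_ge0.
- by apply/measurable_EFinP; exact: measurable_tpow_prod.
- by rewrite mulr_ge0 ?powR_ge0.
rewrite muleA -EFinM; congr (_%:E * _)%E.
rewrite tpow_gt0E// -gt0_powRD//.
rewrite -{1}[t]powRr1 ?ltW// -gt0_powRD//.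
by congr (_ `^ _); ring.
Qed.

(** Translating the inner integral by x turns the product into the double
    integral of tpow p x * tpow q (y - x) * e^(-y); integrating first in x
    leaves a convolution of truncated powers. *)
Lemma eGammaM p q : (eGamma p * eGamma q = eBeta p q * eGamma (p + q))%E.
Proof.
pose f (z : R * R) := (tpow p z.1 * tpow q (z.2 - z.1) * expR (- z.2))%:E.
have mf : measurable_fun setT f.
  apply/measurable_EFinP; apply: measurable_funM; last first.
    by apply: measurableT_comp => //; apply: measurable_funN.
  apply: measurable_funM.
    by apply: (measurableT_comp (measurable_tpow p)).
  apply: (measurableT_comp (measurable_tpow q)).
  exact: measurable_funB.
have f0 z : (0 <= f z)%E.
  by rewrite lee_fin !mulr_ge0 ?expR_ge0 ?tpow_ge0.
have -> : (eGamma p * eGamma q = \int[mu]_x \int[mu]_y f (x, y))%E.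
  rewrite /eGamma -ge0_integralZr//; last 3 first.
  - by apply/measurable_EFinP; exact: measurable_gamma_density.
  - by move=> x _; rewrite lee_fin mulr_ge0 ?tpow_ge0 ?expR_ge0.
  - exact: eGamma_ge0.
  apply: eq_integral => x _.
  rewrite -ge0_integralZl_EFin//; last 3 first.
  - by move=> y _; rewrite lee_fin mulr_ge0 ?tpow_ge0 ?expR_ge0.
  - by apply/measurable_EFinP; exact: measurable_gamma_density.
  - by rewrite mulr_ge0 ?tpow_ge0 ?expR_ge0.
  rewrite [RHS](ge0_integral_affine x ltr01
    (f := fun y => tpow p x * tpow q (y - x) * expR (- y))).
  - rewrite mul1e; apply: eq_integral => y _.
    rewrite mul1r addrK opprD expRD -EFinM; congr EFin.
    by ring.
  - apply: measurable_funM; last first.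
      by apply: measurableT_comp => //; apply: measurable_funN.
    apply: measurable_funM => //.
    apply: (measurableT_comp (measurable_tpow q)).
    exact: measurable_funB.
  - by move=> y; rewrite !mulr_ge0 ?expR_ge0 ?tpow_ge0.
transitivity (\int[mu]_y \int[mu]_x f (x, y))%E; first exact: fubini_tonelli.
rewrite /eGamma muleC -ge0_integralZr//; last 3 first.
- by apply/measurable_EFinP; exact: measurable_gamma_density.
- by move=> x _; rewrite lee_fin mulr_ge0 ?tpow_ge0 ?expR_ge0.
- exact: eBeta_ge0.
apply: eq_integral => t _.
rewrite EFinM muleAC -tpow_conv -ge0_integralZr//; last 2 first.
- by apply/measurable_EFinP; exact: measurable_tpow_prod.
- by move=> x _; rewrite lee_fin mulr_ge0 ?tpow_ge0.
Qed.

End euler_integrals.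

(** * Values, finiteness and lower bound of the Gamma function *)

Section gamma_function.
Context {R : realType}.
Local Notation mu := (@lebesgue_measure R).
Implicit Types p q x s t : R.

(** For p < 1 the integrand is unbounded at 0, so the fundamental theorem of
    calculus is applied on [1/(i+2), 1] and i tends to infinity by monotone
    convergence. *)
Lemma integral_powR_01 p : 0 < p ->
  (\int[mu]_(x in `]0%R, 1%R]) (x `^ (p - 1))%:E = (p^-1)%:E)%E.
Proof.
move=> p0.
(* The shift i + 2 keeps the left endpoint below 1. *)
pose F (i : nat) : set R := `[(i.+2%:R^-1 : R), 1]%classic.
have -> : `]0%R, 1%R]%classic = \bigcup_i F i.
  apply/seteqP; split => x /=.
    rewrite in_itv/= => /andP[x0 x1].
    have [N _ /(_ N (leqnn _)) NE] := near_infty_natSinv_lt (PosNum x0).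
    exists N => //=; rewrite /F/= in_itv/= x1 andbT ltW// (le_lt_trans _ NE)//.
    by rewrite lef_pV2 ?posrE// ler_nat.
  move=> [i _]; rewrite /F/= !in_itv/= => /andP[ix ->].
  by rewrite andbT (lt_le_trans _ ix).
have derivable_pow q x : 0 < x -> derivable (fun y => y `^ q) x 1.
  by move=> x0; apply: derivable_powR; rewrite in_itv/= andbT.
have continuous_pow q x : 0 < x -> {for x, continuous (fun y => y `^ q)}.
  move=> x0; apply: differentiable_continuous; apply/derivable1_diffP.
  exact: derivable_pow.
have ndF : nondecreasing_seq F.
  apply/nondecreasing_seqP => i; rewrite subsetEset; apply: subset_itvr.
  by rewrite bnd_simp lef_pV2 ?posrE// ler_nat.
have mf i : measurable_fun (F i) (fun x => (x `^ (p - 1))%:E).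
  by apply/measurable_EFinP; exact: measurable_funTS.
have f0 i x : F i x -> (0 <= (x `^ (p - 1))%:E)%E by rewrite lee_fin powR_ge0.
have := ge0_nondecreasing_set_cvg_integral
  (mu := lebesgue_measure) ndF (fun=> measurable_itv _) mf f0.
move=> /cvg_lim <- //; apply/cvg_lim => //.
have intF i : (\int[mu]_(x in F i) (x `^ (p - 1))%:E =
    (p^-1 - p^-1 * i.+2%:R^-1 `^ p)%:E)%E.
  rewrite (@continuous_FTC2 _ _ (fun x => p^-1 * x `^ p))//.
  - by rewrite powR1 mulr1 EFinB.
  - by rewrite invf_lt1// ltr1n.
  - apply: derivable_within_continuous => x; rewrite in_itv/= => /andP[ix _].
    by apply: derivable_pow; rewrite (lt_le_trans _ ix)// invr_gt0.
  - split.
    + move=> x; rewrite in_itv/= => /andP[ix _].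
      apply: derivableM => //; apply: derivable_pow.
      by rewrite (lt_trans _ ix)// invr_gt0.
    + apply: cvg_at_right_filter; apply: cvgMr.
      apply: continuous_pow.
      by rewrite invr_gt0.
    + apply: cvg_at_left_filter; apply: cvgMr.
      exact: continuous_pow.
  - move=> x; rewrite in_itv/= => /andP[ix _].
    have x0 : 0 < x by rewrite (lt_trans _ ix)// invr_gt0.
    have H := is_derive1_powR p x0.
    by rewrite derive1E derive_val /= [_ *: _]mulrA mulVf ?mul1r// gt_eqF.
rewrite (_ : (fun i => _) =
    (fun i => (p^-1 - p^-1 * i.+2%:R^-1 `^ p)%:E)); last first.
  by apply/funext => i; rewrite intF.
apply: cvg_EFin; first by near=> i.
rewrite -[X in _ --> X]subr0 -(mulr0 p^-1).
apply: cvgB; first exact: cvg_cst.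
apply: cvgMr.
have /cvg_at_rightP := @powR_cvg0 R p p0.
apply; split; first by move=> n; rewrite invr_gt0.
have := @cvg_harmonic R; rewrite -cvg_shiftS; exact.
Unshelve. all: end_near. Qed.

Lemma eBeta_p1 p : 0 < p -> eBeta p 1 = (p^-1)%:E.
Proof.
move=> p0; rewrite -integral_powR_01// -integral_itv_bndo_bndc; last first.
  by apply/measurable_EFinP; exact: measurable_funTS.
rewrite [RHS]integral_mkcond; apply: eq_integral => x _.
rewrite patchE mem_setE in_itv/=; case: ifPn => [/andP[x0 x1]|].
  by rewrite !tpow_gt0E ?subr_gt0// subrr powRr0 mulr1.
rewrite negb_and -!leNgt => /orP[x0|x1]; first by rewrite tpow_le0// mul0r.
by rewrite (@tpow_le0 _ 1) ?mulr0// subr_le0.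
Qed.

Lemma eGammaE p :
  eGamma p = (\int[mu]_(x in `]0%R, +oo[) (x `^ (p - 1) * expR (- x))%:E)%E.
Proof.
rewrite [RHS]integral_mkcond; apply: eq_integral => x _.
rewrite patchE mem_setE in_itv/= andbT; case: ifPn => [x0|].
  by rewrite !tpow_gt0E.
by rewrite -leNgt => x0; rewrite tpow_le0// mul0r.
Qed.

Lemma eGamma1 : eGamma (1 : R) = 1%E.
Proof.
rewrite eGammaE; under eq_integral do rewrite subrr powRr0 mul1r.
rewrite integral_itv_obnd_cbnd; last first.
  apply/measurable_EFinP/measurable_funTS.
  by apply: measurableT_comp => //; exact: measurable_funN.
have dF x : is_derive x 1 (fun x : R => - expR (- x)) (expR (- x)).
  by apply: is_derive_eq; rewrite ?scaleN1r /= ?mulrN1 ?opprK.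
rewrite (@ge0_continuous_FTC2y _ _ (fun x => - expR (- x)) 0 0).
- by rewrite oppr0 expR0 -EFinB opprK add0r.
- by move=> x _; exact: expR_ge0.
- apply: derivable_within_continuous => x _.
  apply: diff_derivable; apply: differentiable_comp => //.
  exact/derivable1_diffP.
- by rewrite -[X in _ --> X]oppr0; apply: cvgN; exact: cvgr_expR.
- by move=> x _; exact: ex_derive.
- have cF : {for 0, continuous (fun x : R => - expR (- x))}.
    apply: differentiable_continuous.
    by apply/derivable1_diffP; exact: ex_derive.
  exact: cvg_at_right_filter.
- by move=> x _; rewrite derive1E derive_val.
Qed.

(** This is [eGammaM] for q = 1, where B(p, 1) = 1/p and Gamma 1 = 1. *)
Lemma eGammaD1 p : 0 < p -> eGamma (p + 1) = (p%:E * eGamma p)%E.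
Proof.
move=> p0; have := eGammaM p 1; rewrite eGamma1 mule1 eBeta_p1// => ->.
by rewrite muleA -EFinM mulfV ?gt_eqF// mul1e.
Qed.

(** The functional equation gives finiteness at the positive integers. For
    1 <= q the bound x^(q-1) <= 1 + x^n with q <= n + 1 compares with two
    integers, and a last use of the functional equation descends from p + 1
    to p. *)
Lemma eGamma_fin_num p : 0 < p -> eGamma p \is a fin_num.
Proof.
have fin_nat (n : nat) : (eGamma (n.+1%:R : R) < +oo)%E.
  elim: n => [|n ih]; first by rewrite eGamma1 ltry.
  by rewrite -natr1 eGammaD1// lte_mul_pinfty.
have fin_ge1 q : 1 <= q -> (eGamma q < +oo)%E.
  move=> q1; pose n := Num.truncn q.
  apply: (@le_lt_trans _ _ (eGamma 1 + eGamma n.+1%:R)%E); last first.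
    by rewrite lte_add_pinfty// eGamma1 ltry.
  rewrite /eGamma -ge0_integralD//; last 4 first.
  - by move=> x _; rewrite lee_fin mulr_ge0 ?tpow_ge0 ?expR_ge0.
  - by apply/measurable_EFinP; exact: measurable_gamma_density.
  - by move=> x _; rewrite lee_fin mulr_ge0 ?tpow_ge0 ?expR_ge0.
  - by apply/measurable_EFinP; exact: measurable_gamma_density.
  apply: ge0_le_integral => //.
  - by move=> x _; rewrite lee_fin mulr_ge0 ?tpow_ge0 ?expR_ge0.
  - by apply/measurable_EFinP; exact: measurable_gamma_density.
  - by apply: emeasurable_funD; apply/measurable_EFinP;
      exact: measurable_gamma_density.
  - move=> x _; rewrite -EFinD lee_fin -mulrDl ler_wpM2r ?expR_ge0//.
    have [x0|x0] := leP x 0; first by rewrite !tpow_le0// addr0.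
    rewrite !tpow_gt0E// subrr powRr0 -natr1 addrK.
    have [x1|x1] := leP x 1.
      rewrite ler_wpDr ?powR_ge0// -[leRHS](powRr0 x).
      by apply: ger_powR; rewrite ?x0// subr_ge0.
    rewrite ler_wpDl//; apply: ler_powR; first exact: ltW.
    by rewrite lerBlDr natr1 ltW// /n truncnS_gt.
move=> p0; rewrite ge0_fin_numE ?eGamma_ge0//.
have := fin_ge1 (p + 1); rewrite eGammaD1// lerDr ltW// => /(_ isT).
rewrite !ltey; apply: contra => /eqP ->.
by rewrite gt0_muley ?lte_fin.
Qed.

(** Already the part of Euler's integral over [1, 2] is that large: there
    x^(p-1) >= 1/x >= 1/2 and e^(-x) >= e^(-2). *)
Lemma eGamma_ge p : 0 < p -> (((2 * expR 2)^-1)%:E <= eGamma p)%E.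
Proof.
move=> p0.
apply: (@le_trans _ _
  (\int[mu]_(x in `[1%R, 2%R]) (tpow p x * expR (- x))%:E)%E); last first.
  apply: ge0_subset_integral => //.
  - by apply/measurable_EFinP; exact: measurable_gamma_density.
  - by move=> x _; rewrite lee_fin mulr_ge0 ?tpow_ge0 ?expR_ge0.
apply: (@le_trans _ _ (\int[mu]_(x in `[1%R, 2%R]) ((2 * expR 2)^-1)%:E)%E).
  rewrite integral_cst//= lebesgue_measure_itv/= lte_fin ltr1n -EFinD.
  by rewrite (_ : 2 - 1 = 1 :> R) ?mule1//; ring.
apply: ge0_le_integral => //.
- apply/measurable_EFinP; apply: measurable_funTS.
  exact: measurable_gamma_density.
move=> x; rewrite /= in_itv/= => /andP[x1 x2].
have x0 : 0 < x by exact: lt_le_trans x1.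
rewrite lee_fin tpow_gt0E// invfM ler_pM ?invr_ge0 ?expR_ge0//.
  apply: (@le_trans _ _ (x `^ (-1))).
    by rewrite powR_inv1 ?(ltW x0)// lef_pV2 ?posrE.
  by apply: ler_powR => //; rewrite lerDr (ltW p0).
by rewrite -expRN ler_expR lerN2.
Qed.

Lemma GammaE p : 0 < p -> (Gamma p)%:E = eGamma p.
Proof.
move=> p0; rewrite /Gamma p0 /euler_integral /Rintegral -eGammaE.
by rewrite fineK ?eGamma_fin_num.
Qed.

Lemma Gamma_ge p : 0 < p -> (2 * expR 2)^-1 <= Gamma p.
Proof. by move=> p0; rewrite -lee_fin GammaE// eGamma_ge. Qed.

Lemma Gamma_gt0 p : 0 < p -> 0 < Gamma p.
Proof.
move=> p0; apply: (lt_le_trans _ (Gamma_ge p0)).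
by rewrite invr_gt0 mulr_gt0 ?expR_gt0.
Qed.

Lemma GammaD1 p : 0 < p -> Gamma (p + 1) = p * Gamma p.
Proof.
move=> p0; apply: EFin_inj.
by rewrite EFinM !GammaE ?eGammaD1// addr_gt0.
Qed.

Lemma eBetaE p q : 0 < p -> 0 < q ->
  eBeta p q = (Gamma p * Gamma q / Gamma (p + q))%:E.
Proof.
move=> p0 q0; have pq0 : 0 < p + q by rewrite addr_gt0.
rewrite EFinM EFinM !GammaE// eGammaM -GammaE// -muleA -EFinM.
by rewrite mulfV ?mule1// gt_eqF// Gamma_gt0.
Qed.

Lemma beta_integral p q t : 0 < p -> 0 < q -> 0 < t ->
  (\int[mu]_(s in `]0%R, t[) (s `^ (p - 1) * (t - s) `^ (q - 1))%:E =
   (t `^ (p + q - 1) * (Gamma p * Gamma q / Gamma (p + q)))%:E)%E.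
Proof.
move=> p0 q0 t0; rewrite EFinM -eBetaE// -tpow_gt0E// -tpow_conv.
rewrite integral_mkcond; apply: eq_integral => x _.
rewrite patchE mem_setE in_itv/=; case: ifPn => [/andP[x0 x1]|].
  by rewrite !tpow_gt0E ?subr_gt0.
rewrite negb_and -!leNgt => /orP[x0|x1]; first by rewrite tpow_le0// mul0r.
by rewrite (@tpow_le0 _ q) ?mulr0// subr_le0.
Qed.

End gamma_function.

(** * The Wright series and its derivatives *)

Section wright_function.
Context {R : realType}.
Local Notation mu := (@lebesgue_measure R).
Implicit Types l m q s t z : R.

Definition Wright_coef l m (n : nat) : R :=
  (n`!%:R)^-1 * (Gamma (l * n%:R + m))^-1.

Lemma WrightE l m z : Wright l m z = limn (pseries (Wright_coef l m) z).
Proof.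
congr (lim (_ @ \oo)); congr series; apply/funext => n.
by rewrite [RHS]mulrC mulrA.
Qed.

Lemma Wright_arg_gt0 l m n : 0 <= l -> 0 < m -> 0 < l * n%:R + m.
Proof. by move=> l0 m0; rewrite ltr_wpDl// mulr_ge0. Qed.

(** Since 1 / Gamma is bounded by 2 e^2 on the positive half-line, the Wright
    series is dominated by the exponential series. *)
Lemma Wright_term_le l m z n : 0 <= l -> 0 < m ->
  `|Wright_coef l m n * z ^+ n| <= (2 * expR 2) * exp_coeff `|z| n.
Proof.
move=> l0 m0; have a0 := Wright_arg_gt0 n l0 m0.
have G0 := Gamma_gt0 a0.
have c0 : 0 <= Wright_coef l m n by rewrite mulr_ge0// invr_ge0 ltW.
rewrite normrM normrX (ger0_norm c0) /Wright_coef.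
rewrite mulrAC mulrC /exp_coeff/= [X in _ * X]mulrC.
rewrite ler_wpM2r ?divr_ge0 ?exprn_ge0//.
rewrite -[leRHS]invrK lef_pV2 ?posrE ?invr_gt0 ?mulr_gt0 ?expR_gt0//.
exact: Gamma_ge.
Qed.

Lemma is_cvg_Wright l m z : 0 <= l -> 0 < m ->
  cvgn (pseries (Wright_coef l m) z).
Proof.
move=> l0 m0; apply: normed_cvg.
apply: (@series_le_cvg _ _ ((2 * expR 2) *: exp_coeff `|z|)) => [n|n|n|].
- exact: normr_ge0.
- by rewrite mulr_ge0 ?exp_coeff_ge0// mulr_ge0 ?expR_ge0.
- exact: Wright_term_le.
- exact/is_cvg_seriesZ/is_cvg_series_exp_coeff.
Qed.

(** A bound uniform in n, which provides the dominating function when the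
    series is integrated term by term. *)
Lemma Wright_partial_sum_le l m z n : 0 <= l -> 0 < m ->
  `|pseries (Wright_coef l m) z n| <= (2 * expR 2) * expR `|z|.
Proof.
move=> l0 m0.
apply: (le_trans (ler_norm_sum _ _ _)).
apply: (@le_trans _ _ (\sum_(0 <= k < n) (2 * expR 2) * exp_coeff `|z| k)).
  by apply: ler_sum => k _; exact: Wright_term_le.
rewrite -mulr_sumr ler_wpM2l ?mulr_ge0 ?expR_ge0//.
apply: nondecreasing_cvgn_le; last exact: is_cvg_series_exp_coeff.
by apply: nondecreasing_series => k _ _; exact: exp_coeff_ge0.
Qed.

(** Shifting the index of the series trades l (n + 1) + m for l n + (l + m). *)
Lemma pseries_diffs_Wright l m :
  pseries_diffs (Wright_coef l m) = Wright_coef l (l + m).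
Proof.
apply/funext => n; rewrite /pseries_diffs /Wright_coef factS natrM invfM.
rewrite !mulrA mulfV// mul1r; congr (_ / Gamma _).
by rewrite -natr1; ring.
Qed.

Lemma is_derive_Wright l m z : 0 <= l -> 0 < m ->
  is_derive z 1 (Wright l m) (Wright l (l + m) z).
Proof.
move=> l0 m0.
have -> : Wright l m = fun z => limn (pseries (Wright_coef l m) z).
  by apply/funext => x; exact: WrightE.
rewrite WrightE -pseries_diffs_Wright.
have lm0 : 0 < l + m by rewrite ltr_wpDl.
(* The radius of convergence is infinite: any point beyond |z| will do. *)
apply: (@pseries_snd_diffs _ _ (`|z| + 1)).
- exact: is_cvg_Wright.
- by rewrite pseries_diffs_Wright; exact: is_cvg_Wright.
- rewrite !pseries_diffs_Wright; apply: is_cvg_Wright => //.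
  by rewrite ltr_wpDl.
- by rewrite [ltRHS]ger0_norm ?addr_ge0// ltrDl.
Qed.

(** Coefficientwise this is the functional equation of Gamma: the n-th
    coefficient of the left-hand side carries the factor
    (m - 1 + l n) / Gamma (l n + m) = 1 / Gamma (l n + m - 1). *)
Lemma Wright_rec l m z : 0 <= l -> 1 < m ->
  (m - 1) * Wright l m z + l * z * Wright l (l + m) z = Wright l (m - 1) z.
Proof.
move=> l0 m1; have m0 : 0 < m by exact: lt_trans m1.
have m10 : 0 < m - 1 by rewrite subr_gt0.
rewrite !WrightE.
have /pseries_diffs_equiv : cvgn (pseries (pseries_diffs (Wright_coef l m)) z).
  by rewrite pseries_diffs_Wright; apply: is_cvg_Wright => //; rewrite ltr_wpDl.
rewrite pseries_diffs_Wright /= => dW.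
apply/esym/cvg_lim => //.
rewrite [X in X @ \oo --> _](_ : _ =
  (fun n => (m - 1) * pseries (Wright_coef l m) z n +
   l * z * series (fun i => i%:R * Wright_coef l m i * z ^+ i.-1) n));
  last first.
  apply/funext => n; rewrite /pseries /series/= !mulr_sumr -big_split/=.
  apply: eq_bigr => k _.
  have -> : l * z * (k%:R * Wright_coef l m k * z ^+ k.-1) =
            (l * k%:R) * Wright_coef l m k * z ^+ k.
    (* For k = 0 the exponent k.-1 is not k - 1, but the factor k vanishes. *)
    case: k => [|k]; first by rewrite !(mulr0, mul0r).
    by rewrite exprS/=; ring.
  rewrite mulrA -mulrDl; congr (_ * _); rewrite -mulrDl /Wright_coef.
  have a0 := Wright_arg_gt0 k l0 m10.
  have -> : l * k%:R + m = l * k%:R + (m - 1) + 1 by ring.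
  rewrite GammaD1// invfM (addrC (m - 1)) mulrCA mulVKf// gt_eqF//.
apply: cvgD; first by apply: cvgMr; exact: is_cvg_Wright.
exact: cvgMr.
Qed.

Lemma is_derive_Wright_powR b m t : 0 < b -> 0 < m -> 0 < t ->
  is_derive t 1 (fun s => Wright b m (- (s `^ b)))
    (Wright b (b + m) (- (t `^ b)) * - (b * t `^ (b - 1))).
Proof.
move=> b0 m0 t0; have db := is_derive1_powR b t0.
have dNb : is_derive t 1 (fun s => - (s `^ b)) (- (b * t `^ (b - 1))).
  exact: is_deriveN.
have dW := is_derive_Wright (- (t `^ b)) (ltW b0) m0.
by have := is_derive1_comp (g := fun s => - (s `^ b)) dW dNb.
Qed.

(** The product and chain rules give t^(m-2) times the left-hand side of
    [Wright_rec] at z = -t^b. *)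
Lemma is_derive_powR_Wright b m t : 0 < b -> 1 < m -> 0 < t ->
  is_derive t 1 (fun s => s `^ (m - 1) * Wright b m (- (s `^ b)))
    (t `^ (m - 1 - 1) * Wright b (m - 1) (- (t `^ b))).
Proof.
move=> b0 m1 t0.
have dp := is_derive1_powR (m - 1) t0.
have dW := is_derive_Wright_powR b0 (lt_trans ltr01 m1) t0.
have := is_deriveM dp dW.
move=> H; apply: is_derive_eq.
rewrite -(Wright_rec _ (ltW b0) m1) /GRing.scale/=.
have -> : t `^ (m - 1) = t `^ (m - 1 - 1) * t.
  by rewrite -{3}[t]powRr1 ?(ltW t0)// -gt0_powRD// subrK.
have -> : t `^ b = t * t `^ (b - 1).
  by rewrite -{2}[t]powRr1 ?(ltW t0)// -gt0_powRD// addrC subrK.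
ring.
Qed.

End wright_function.

(** * Fractional integrals of the Wright function *)

Section fractional_integral.
Context {R : realType}.
Local Notation mu := (@lebesgue_measure R).
Implicit Types b m q s t : R.

Lemma measurable_beta_density p q t :
  measurable_fun setT (fun s : R => s `^ (p - 1) * (t - s) `^ (q - 1)).
Proof.
apply: measurable_funM => //.
apply: (measurableT_comp (measurable_powR _)).
exact: measurable_funB.
Qed.

Lemma integrable_beta_density p q t : 0 < p -> 0 < q -> 0 < t ->
  mu.-integrable `]0, t[ (fun s : R => (s `^ (p - 1) * (t - s) `^ (q - 1))%:E).
Proof.
move=> p0 q0 t0; apply/integrableP; split.
  apply/measurable_EFinP; apply: measurable_funTS.
  exact: measurable_beta_density.
under eq_integral do rewrite gee0_abs ?lee_fin ?mulr_ge0 ?powR_ge0//.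
by rewrite beta_integral// ltry.
Qed.

Lemma measurable_Wright l m : 0 <= l -> 0 < m ->
  measurable_fun setT (@Wright R l m).
Proof.
move=> l0 m0; apply: continuous_measurable_fun => z.
have dW := is_derive_Wright z l0 m0.
by apply: differentiable_continuous; apply/derivable1_diffP; exact: ex_derive.
Qed.

(** On t > 0 the k-th term of the series is a multiple of the power t^(b k),
    which merges with the weight s^(m-1) into another beta integral; its value
    turns the coefficient for m into the one for m + q. *)
Lemma integral_beta_Wright_term b m q t (k : nat) :
  0 < b -> 0 < m -> 0 < q -> 0 < t ->
  let f s := s `^ (m - 1) * (t - s) `^ (q - 1) *
    (Wright_coef b m k * (- (s `^ b)) ^+ k) in
  mu.-integrable `]0, t[ (EFin \o f) /\
  (\int[mu]_(s in `]0%R, t[) (f s)%:E =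
   (Gamma q * t `^ (m + q - 1) *
    (Wright_coef b (m + q) k * (- (t `^ b)) ^+ k))%:E)%E.
Proof.
move=> b0 m0 q0 t0 f; have a0 := Wright_arg_gt0 k (ltW b0) m0.
have powRX x : 0 < x -> (- (x `^ b)) ^+ k = (-1) ^+ k * x `^ (b * k%:R).
  by move=> x0; rewrite -[- (x `^ b)]mulN1r exprMn powRrM powR_mulrn ?powR_ge0.
pose c : R := Wright_coef b m k * (-1) ^+ k.
have fE : {in `]0, t[%classic, (fun s => c%:E *
    (s `^ (b * k%:R + m - 1) * (t - s) `^ (q - 1))%:E)%E =1 EFin \o f}.
  move=> s; rewrite inE/= in_itv/= => /andP[s0 _].
  rewrite /f powRX// -[b * k%:R + m - 1]addrA (gt0_powRD _ (m - 1) s0).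
  by rewrite /c; congr EFin; ring.
split.
  apply: (@eq_integrable _ _ _ mu _ (measurable_itv _) _ _ fE).
  by apply: integrableZl => //; exact: integrable_beta_density.
transitivity (\int[mu]_(s in `]0%R, t[) (c%:E *
    (s `^ (b * k%:R + m - 1) * (t - s) `^ (q - 1))%:E))%E.
  by apply: eq_integral => s st; exact/esym/fE.
rewrite integralZl//; last exact: integrable_beta_density.
rewrite beta_integral// -EFinM powRX//; congr EFin.
have -> : b * k%:R + m + q - 1 = m + q - 1 + b * k%:R by ring.
rewrite (gt0_powRD _ (b * k%:R) t0) /c /Wright_coef -(addrA (b * k%:R)).
have /lt0r_neq0 G0 := Gamma_gt0 a0.
have mq0 : 0 < m + q by rewrite addr_gt0.
have /lt0r_neq0 G1 := Gamma_gt0 (Wright_arg_gt0 k (ltW b0) mq0).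
have F0 : k`!%:R != 0 :> R by rewrite pnatr_eq0 -lt0n fact_gt0.
by field; rewrite G0 G1 F0.
Qed.

(** Up to the factor Gamma q this is the Riemann-Liouville integral of order q.
    The partial sums of the series are bounded by 2 e^2 e^(t^b) on the interval,
    so dominated convergence reduces the claim to
    [integral_beta_Wright_term]. *)
Lemma fractional_integral_Wright b m q t : 0 < b -> 0 < m -> 0 < q -> 0 < t ->
  let f s := s `^ (m - 1) * (t - s) `^ (q - 1) * Wright b m (- (s `^ b)) in
  mu.-integrable `]0, t[ (EFin \o f) /\
  (\int[mu]_(s in `]0, t[) f s =
    Gamma q * t `^ (m + q - 1) * Wright b (m + q) (- (t `^ b)))%R.
Proof.
move=> b0 m0 q0 t0 f.
have mq0 : 0 < m + q by rewrite addr_gt0.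
pose k s := s `^ (m - 1) * (t - s) `^ (q - 1).
have k0 s : 0 <= k s by rewrite mulr_ge0 ?powR_ge0.
pose f_ n s := (k s * pseries (Wright_coef b m) (- (s `^ b)) n)%:E.
pose B := (2 * expR 2) * expR (t `^ b).
have mNpow : measurable_fun setT (fun s : R => - (s `^ b)).
  exact: measurable_funN.
have mf_ n : measurable_fun `]0, t[ (f_ n).
  apply/measurable_EFinP; apply: measurable_funTS; apply: measurable_funM.
    exact: measurable_beta_density.
  apply: measurable_sum => i; apply: measurable_funM => //.
  exact: measurable_funX.
have mf : measurable_fun `]0, t[ (EFin \o f).
  apply/measurable_EFinP; apply: measurable_funTS; apply: measurable_funM.
    exact: measurable_beta_density.
  by apply: (measurableT_comp (measurable_Wright (ltW b0) m0)).
have cvg_f_ : {ae mu, forall s, `]0, t[%classic s ->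
    f_ ^~ s @ \oo --> (EFin \o f) s}.
  apply: aeW => s _; apply: cvg_EFin; first by near=> n.
  rewrite /f WrightE; apply: cvgMr.
  exact: is_cvg_Wright (ltW b0) m0.
have ig : mu.-integrable `]0, t[ (fun s => B%:E * (k s)%:E)%E.
  by apply: integrableZl => //; exact: integrable_beta_density.
have f_le : {ae mu, forall s n, `]0, t[%classic s ->
    (`|f_ n s| <= B%:E * (k s)%:E)%E}.
  apply: aeW => s n; rewrite /= in_itv/= => /andP[s0 st].
  rewrite lee_fin normrM (ger0_norm (k0 s)) mulrC ler_wpM2r//.
  apply: (le_trans (Wright_partial_sum_le _ _ (ltW b0) m0)).
  rewrite ler_wpM2l ?mulr_ge0 ?expR_ge0// ler_expR normrN ger0_norm ?powR_ge0//.
  by apply: ge0_ler_powR; rewrite ?nnegrE; apply: ltW.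
have [intf _ cvgi] := dominated_convergence
  (mu := lebesgue_measure) (measurable_itv _) mf_ mf cvg_f_ ig f_le.
split => //.
suff : (\int[mu]_(s in `]0%R, t[) (EFin \o f) s =
   (Gamma q * t `^ (m + q - 1) * Wright b (m + q) (- (t `^ b)))%:E)%E.
  by rewrite /Rintegral/= => ->.
move/cvg_lim : cvgi => <- //.
apply/cvg_lim => //.
have int_f_ n : (\int[mu]_(s in `]0%R, t[) f_ n s =
   (Gamma q * t `^ (m + q - 1) *
    pseries (Wright_coef b (m + q)) (- (t `^ b)) n)%:E)%E.
  rewrite (_ : f_ n = fun s => \sum_(0 <= i < n)
      (k s * (Wright_coef b m i * (- (s `^ b)) ^+ i))%:E)%E; last first.
    by apply/funext => s; rewrite sumEFin -mulr_sumr.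
  rewrite integral_sum//; last first.
    by move=> i; exact: (integral_beta_Wright_term i b0 m0 q0 t0).1.
  rewrite mulr_sumr -sumEFin; apply: eq_bigr => i _.
  exact: (integral_beta_Wright_term i b0 m0 q0 t0).2.
under eq_fun do rewrite int_f_.
apply: cvg_EFin; first by near=> n.
rewrite WrightE; apply: cvgMr; exact: is_cvg_Wright (ltW b0) mq0.
Unshelve. all: end_near. Qed.

End fractional_integral.

(** * The fractional equation *)

Unset Implicit Arguments.

Theorem proposition1 (R : realType) (beta nu : R)
    (hbeta : 0 < beta < 1) (hnu : 0 <= nu) (hbetanu : 1 < beta + nu) :
  is_solution beta nu
    (fun x t => expR (- x) * Wright beta nu (- (t `^ beta))).
Proof.
have /andP[b0 b1] := hbeta.
have nu0 : 0 < nu by lra.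
have m0 : 0 < beta + nu - 1 by rewrite subr_gt0.
have q0 : 0 < 1 - beta by rewrite subr_gt0.
move=> x t t0 u_t u_x g.
have du_x (y s : R) :
    is_derive y (1 : R)
      (fun y : R => expR (- y) * Wright beta nu (- (s `^ beta)))
    (- (expR (- y) * Wright beta nu (- (s `^ beta)))).
  by apply: is_derive_eq; rewrite /GRing.scale/=; ring.
have du_t (s : R) : 0 < s ->
    is_derive s (1 : R)
      (fun s : R => expR (- x) * Wright beta nu (- (s `^ beta)))
      (expR (- x) * (Wright beta (beta + nu) (- (s `^ beta)) *
        - (beta * s `^ (beta - 1)))).
  move=> s0; have dW := is_derive_Wright_powR b0 nu0 s0.
  exact (is_deriveZ (expR (- x)) dW).
(* K is minus beta times the spatial factor: K W_nu = - beta u at the end. *)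
pose K := - beta * expR (- x).
have gE (s : R) : 0 < s -> g s =
    K * (s `^ (beta + nu - 1) * Wright beta (beta + nu) (- (s `^ beta))).
  move=> s0; rewrite /g /u_t derive1E (@derive_val _ _ _ _ _ _ _ (du_t s s0)).
  have -> : beta + nu - 1 = nu + (beta - 1) by ring.
  by rewrite (gt0_powRD nu (beta - 1) s0) /K; ring.
have dg (s : R) : 0 < s -> is_derive s (1 : R) g
    (K * (s `^ (beta + nu - 1 - 1) *
      Wright beta (beta + nu - 1) (- (s `^ beta)))).
  move=> s0.
  have dh := is_derive_powR_Wright b0 hbetanu s0.
  have dKh := is_deriveZ K dh.
  apply: near_eq_is_derive dKh => //.
  by near=> z; rewrite gE//; near: z; exact: lt_nbhsr.
have [intf intfE] := fractional_integral_Wright b0 m0 q0 t0.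
have fE : {in `]0, t[%classic, (fun s => K%:E * (s `^ (beta + nu - 1 - 1) *
      (t - s) `^ (1 - beta - 1) *
      Wright beta (beta + nu - 1) (- (s `^ beta)))%:E)%E
    =1 EFin \o caputo_integrand beta g t}.
  move=> s; rewrite inE/= in_itv/= => /andP[s0 st].
  rewrite /caputo_integrand derive1E (@derive_val _ _ _ _ _ _ _ (dg s s0)).
  have -> : 1 - beta - 1 = - beta by ring.
  by rewrite powRN -EFinM; congr EFin; ring.
split.
- exact: (@ex_derive _ _ _ _ _ _ _ (du_t t t0)).
- exact: (@ex_derive _ _ _ _ _ _ _ (du_x x t)).
- split.
    by move=> s /andP[s0 _]; exact: (@ex_derive _ _ _ _ _ _ _ (dg s s0)).
  apply: (@eq_integrable _ _ _ lebesgue_measure _ (measurable_itv _) _ _ fE).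
  exact: integrableZl.
- have -> : u_x x = - (expR (- x) * Wright beta nu (- (t `^ beta))).
    by rewrite /u_x derive1E (@derive_val _ _ _ _ _ _ _ (du_x x t)).
  have -> : caputo beta g t = (Gamma (1 - beta))^-1 * (K *
      (Gamma (1 - beta) * t `^ (beta + nu - 1 + (1 - beta) - 1) *
       Wright beta (beta + nu - 1 + (1 - beta)) (- (t `^ beta)))).
    rewrite -intfE -RintegralZl// /caputo /Rintegral.
    by congr (_ * fine _); apply: eq_integral => s st; exact/esym/fE.
  have -> : beta + nu - 1 + (1 - beta) = nu by ring.
  have tt : t `^ (1 - nu) * t `^ (nu - 1) = 1.
    by rewrite -gt0_powRD// (_ : 1 - nu + (nu - 1) = 0) ?powRr0//; ring.
  have /lt0r_neq0 G0 := Gamma_gt0 q0.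
  have -> : t `^ (1 - nu) * ((Gamma (1 - beta))^-1 *
      (K * (Gamma (1 - beta) * t `^ (nu - 1) * Wright beta nu (- t `^ beta)))) =
      t `^ (1 - nu) * t `^ (nu - 1) * (K * Wright beta nu (- t `^ beta)).
    by field.
  by rewrite tt mul1r /K; ring.
Unshelve. all: end_near. Qed.
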